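(* Let $A$ be a non-deterministic timed automaton and let $\widetilde{A}$ be its discretized timed automaton. Then $$d(\mathfrak{L}(A),\mathfrak{L}(\widetilde{A}))\le \tfrac12,$$ where for timed languages $d(\mathfrak{L}_1,\mathfrak{L}_2)=\max\{c(\mathfrak{L}_1,\mathfrak{L}_2),c(\mathfrak{L}_2,\mathfrak{L}_1)\}$.
   Context: **Timed automata.** A non-deterministic timed automaton is a tuple $A=(\mathcal{Q},q_0,\mathcal{F},\Sigma,\mathcal{C},\mathcal{T})$ with: - a finite set $\mathcal{Q}$ of locations, an initial location $q_0$, and accepting locations $\mathcal{F}$; - a finite action set $\Sigma$ and a finite clock set $\mathcal{C}$; - transitions $(q,a,g,\mathcal{C}_{rst},q')$, where the guard $g$ is a conjunction of constraints $c\sim n$ with $\sim\in\{<,\le,=,\ge,>\}$, and $\mathcal{C}_{rst}$ is the set of clocks that are reset. Guard constants are normally in $\mathbb{N}_0$; constants in $\frac12\mathbb{N}_0$ are also allowed, with the same semantics. Runs start in $(q_0,\mathbf{0})$ and alternate delays $(q,v)\xrightarrow{d}(q,v+d)$ with jumps $(q,v)\xrightarrow{a}(q',v[\mathcal{C}_{rst}])$. A jump along a transition is allowed only if $v$ satisfies its guard. A run with delays $d_1,\dots,d_k$ and actions $a_1,\dots,a_k$ induces the timed trace $(t_1,a_1),\dots,(t_k,a_k)$ with $t_i=\sum_{j\le i}d_j$. The language $\mathfrak{L}(A)$ consists of the timed traces of runs ending in an accepting location. **Distances.** $d(\tau_1,\tau_2)=\infty$ if the two traces differ in length or in some action. Otherwise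 $d(\tau_1,\tau_2)=\max_i|t^{1}_i-t^{2}_i|$. The conformance distance is $c(\mathfrak{L}_1,\mathfrak{L}_2)=\sup_{\tau_1\in\mathfrak{L}_1}\inf_{\tau_2\in\mathfrak{L}_2}d(\tau_1,\tau_2)$. **Augmented region automaton $\mathfrak{R}^t(A)$.** - Let $A$ have clocks $x_1,\dots,x_s$ and let $M$ be the largest constant in its guards. Add a clock $t=x_0$ that measures absolute time: it is never reset and does not occur in guards. - A region is a pair $(\mathbf n,\Delta)$, where $\mathbf n\in\{0,1,\dots,M,\top\}^s$ gives the integral parts of $x_1,\dots,x_s$ ($\top$ means the value exceeds $M$). $\Delta$ is an ordering $0\preceq_0\{x_{i_0}\}\preceq_1\cdots\preceq_s\{x_{i_s}\}<1$ of the fractional parts of $x_0,\dots,x_s$, with each $\preceq_j\in\{=,<\}$. The integral part of $t$ is not recorded; only whether $\{t\}=0$ and its order relative to the other fractional parts. - Vertices are pairs $(q,r)$ with $q$ a location and $r$ a region. The initial vertex is $(q_0,\mathbf 0,\mathbf 0)$. - There is an edge $(q,r)\xrightarrow{a}(q',r')$ of weight $m\in\mathbb{N}_0$ iff some run of $A$ (extended by $t$) contains $(q,v)\xrightarrow{d}(q,v+d)\xrightarrow{a}(q',v')$ with $v\in r$, $v'\in r'$ and $m=\lfloor v'(t)\rfloor-\lfloor v(t)\rfloor$. - Parallel edges with different weights may exist. An infinite set of consecutive weights $m,m+1,m+2,\dots$ between the same two vertices is represented by one edge of weight $m^*$. **Discretized timed automaton $\widetilde{A}$.** - It has the same vertices,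 initial vertex, edges and action labels as $\mathfrak{R}^t(A)$. A vertex $(q,r)$ is accepting iff $q\in\mathcal{F}$. - It has a single clock $t$, reset on every transition. - For an edge $e$ whose source region has fractional part of $t$ equal to $\{t_0\}$ and whose target region has $\{t_1\}$, let $\delta=\frac12(\lceil\{t_1\}\rceil-\lceil\{t_0\}\rceil)\in\{-\frac12,0,\frac12\}$. - The guard of $e$ is $t=w(e)+\delta$ if its weight is $w(e)=m$, and $t\ge m+\delta$ if its weight is $m^*$.
   Formalization: The guard constants of $A$ are assumed to lie in $\mathbb{N}_0$; half-integer constants (as allowed for $\widetilde A$) are excluded for $A$, since the region construction does not distinguish them and the bound then fails. *)

(* Defs.v *)
From Stdlib Require Import Reals List ClassicalEpsilon.
From Coquelicot Require Import Rbar Lub.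
Import ListNotations.
Open Scope R_scope.

Inductive cmp := CLt | CLe | CEq | CGe | CGt.

Record atom := mkAtom { a_clk : nat; a_op : cmp; a_const : R }.

Definition sat_atom (v : nat -> R) (c : atom) : Prop :=
  let x := v (a_clk c) in
  match a_op c with
  | CLt => x < a_const c
  | CLe => x <= a_const c
  | CEq => x = a_const c
  | CGe => x >= a_const c
  | CGt => x > a_const c
  end.

Definition sat_guard (g : list atom) (v : nat -> R) : Prop := Forall (sat_atom v) g.

Record transition (L Sigma : Type) := mkTrans {
  t_src : L; t_act : Sigma; t_guard : list atom; t_reset : list nat; t_dst : L }.
Arguments mkTrans {L Sigma}.
Arguments t_src {L Sigma}. Arguments t_act {L Sigma}. Arguments t_guard {L Sigma}.
Arguments t_reset {L Sigma}. Arguments t_dst {L Sigma}.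

(* A timed automaton with location type L and action type Sigma; its clocks are
   the indices 0 .. ta_nclocks - 1. *)
Record TA (L Sigma : Type) := mkTA {
  ta_init : L;
  ta_acc : L -> Prop;
  ta_nclocks : nat;
  ta_trans : transition L Sigma -> Prop }.
Arguments mkTA {L Sigma}.
Arguments ta_init {L Sigma}. Arguments ta_acc {L Sigma}.
Arguments ta_nclocks {L Sigma}. Arguments ta_trans {L Sigma}.

Definition finite_TA {L Sigma} (A : TA L Sigma) : Prop :=
  (exists lq : list L, forall q, In q lq) /\
  (exists la : list Sigma, forall a, In a la) /\
  (exists lt : list (transition L Sigma), forall tr, ta_trans A tr <-> In tr lt) /\
  (forall tr, ta_trans A tr ->
     Forall (fun c => (a_clk c < ta_nclocks A)%nat) (t_guard tr) /\
     Forall (fun x => (x < ta_nclocks A)%nat) (t_reset tr)).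

Definition nat_constants {L Sigma} (A : TA L Sigma) : Prop :=
  forall tr c, ta_trans A tr -> In c (t_guard tr) -> exists n : nat, a_const c = INR n.

Definition is_max_const {L Sigma} (A : TA L Sigma) (M : nat) : Prop :=
  (forall tr c, ta_trans A tr -> In c (t_guard tr) -> a_const c <= INR M) /\
  (M = 0%nat \/ exists tr c, ta_trans A tr /\ In c (t_guard tr) /\ a_const c = INR M).

Definition shift (v : nat -> R) (d : R) : nat -> R := fun i => v i + d.
Definition reset (C : list nat) (v : nat -> R) : nat -> R :=
  fun i => if in_dec Nat.eq_dec i C then 0 else v i.
Definition zero_val : nat -> R := fun _ => 0.

Definition timed_trace (Sigma : Type) := list (R * Sigma).

(* accepting runs from (q, v) at absolute time [now], producing the given timed
   trace (absolute time stamps t_i = sum of delays) *)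
Inductive acc_run {L Sigma} (A : TA L Sigma) : L -> (nat -> R) -> R -> timed_trace Sigma -> Prop :=
| acc_nil q v now : ta_acc A q -> acc_run A q v now []
| acc_cons q v now d tr rest :
    0 <= d -> ta_trans A tr -> t_src tr = q -> sat_guard (t_guard tr) (shift v d) ->
    acc_run A (t_dst tr) (reset (t_reset tr) (shift v d)) (now + d) rest ->
    acc_run A q v now ((now + d, t_act tr) :: rest).

Definition lang {L Sigma} (A : TA L Sigma) : timed_trace Sigma -> Prop :=
  fun tau => acc_run A (ta_init A) zero_val 0 tau.

Inductive reach {L Sigma} (A : TA L Sigma) : L -> (nat -> R) -> R -> Prop :=
| reach_init : reach A (ta_init A) zero_val 0
| reach_step q v t d tr :
    reach A q v t -> 0 <= d -> ta_trans A tr -> t_src tr = q ->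
    sat_guard (t_guard tr) (shift v d) ->
    reach A (t_dst tr) (reset (t_reset tr) (shift v d)) (t + d).

Definition Rbar_maxb (x y : Rbar) : Rbar :=
  match x, y with
  | p_infty, _ | _, p_infty => p_infty
  | m_infty, z | z, m_infty => z
  | Finite a, Finite b => Finite (Rmax a b)
  end.

Fixpoint tdist {Sigma} (t1 t2 : timed_trace Sigma) : Rbar :=
  match t1, t2 with
  | [], [] => Finite 0
  | (x1, a1) :: r1, (x2, a2) :: r2 =>
      if excluded_middle_informative (a1 = a2)
      then Rbar_maxb (Finite (Rabs (x1 - x2))) (tdist r1 r2)
      else p_infty
  | _, _ => p_infty
  end.

Definition conf {Sigma} (L1 L2 : timed_trace Sigma -> Prop) : Rbar :=
  Rbar_lub (fun x => exists t1, L1 t1 /\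
     x = Rbar_glb (fun y => exists t2, L2 t2 /\ y = tdist t1 t2)).

Definition lang_dist {Sigma} (L1 L2 : timed_trace Sigma -> Prop) : Rbar :=
  Rbar_maxb (conf L1 L2) (conf L2 L1).

(* extended valuation: (value of t = x_0, values of x_1..x_s at indices 0..s-1) *)
Definition extval := (R * (nat -> R))%type.
Definition xval (w : extval) (i : nat) : R :=
  match i with O => fst w | S j => snd w j end.

(* integral part, or None (= top) if the value exceeds M *)
Definition capfloor (M : nat) (y : R) : option Z :=
  if Rle_dec y (INR M) then Some (Int_part y) else None.

Definition region_eq (M s : nat) (w w' : extval) : Prop :=
  (forall i, (i < s)%nat -> capfloor M (snd w i) = capfloor M (snd w' i)) /\
  (forall i j, (i <= s)%nat -> (j <= s)%nat ->
     (frac_part (xval w i) <= frac_part (xval w j) <->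
      frac_part (xval w' i) <= frac_part (xval w' j))) /\
  (forall i, (i <= s)%nat ->
     (frac_part (xval w i) = 0 <-> frac_part (xval w' i) = 0)).

Definition region := extval -> Prop.
Definition region_of (M s : nat) (w : extval) : region := region_eq M s w.

Definition vertex (L : Type) := (L * region)%type.

Definition weighted_edge {L Sigma} (A : TA L Sigma) (M : nat)
    (q : L) (r : region) (a : Sigma) (q' : L) (r' : region) (m : nat) : Prop :=
  exists v t d tr,
    reach A q v t /\ 0 <= d /\ ta_trans A tr /\
    t_src tr = q /\ t_act tr = a /\ t_dst tr = q' /\
    sat_guard (t_guard tr) (shift v d) /\
    r = region_of M (ta_nclocks A) (t, v) /\
    r' = region_of M (ta_nclocks A) (t + d, reset (t_reset tr) (shift v d)) /\
    INR m = IZR (Int_part (t + d)) - IZR (Int_part t).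

Definition ceil_frac (y : R) : R :=
  if Req_EM_T (frac_part y) 0 then 0 else 1.

(* transitions of A~ : one clock (index 0) = t, reset on every transition.
   For the weights W = {m | weighted_edge ... m}: an edge t = m + delta for each
   m in W not belonging to the infinite tail {m0, m0+1, ...} of W, and one edge
   t >= m0 + delta (weight m0^* ) for the least m0 with {m0, m0+1, ...} in W. *)
Definition disc_trans {L Sigma} (A : TA L Sigma) (M : nat)
    (tr : transition (vertex L) Sigma) : Prop :=
  exists q w a q' w',
    let r := region_of M (ta_nclocks A) w in
    let r' := region_of M (ta_nclocks A) w' in
    let delta := (ceil_frac (fst w') - ceil_frac (fst w)) / 2 in
    let W := weighted_edge A M q r a q' r' in
    t_src tr = (q, r) /\ t_act tr = a /\ t_dst tr = (q', r') /\
    t_reset tr = [0%nat] /\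
    ((exists m, W m /\ ~ (forall j, (m <= j)%nat -> W j) /\
        t_guard tr = [mkAtom 0 CEq (INR m + delta)]) \/
     (exists m, (forall j, (m <= j)%nat -> W j) /\
        (m = 0%nat \/ ~ W (m - 1)%nat) /\
        t_guard tr = [mkAtom 0 CGe (INR m + delta)])).

Definition discretize {L Sigma} (A : TA L Sigma) (M : nat) : TA (vertex L) Sigma :=
  mkTA (ta_init A, region_of M (ta_nclocks A) (0, zero_val))
       (fun p => ta_acc A (fst p))
       1%nat
       (disc_trans A M).

(* Main.v *)
Require Import Defs.
From Stdlib Require Import Reals.
From Coquelicot Require Import Rbar.
From Stdlib Require Import Znat List Lra Lia Classical ClassicalEpsilon.
From Coquelicot Require Import Lub.
Import ListNotations.
Open Scope R_scope.

(** Round a time [t] to [floor t] if it is an integer and to [floor t + 1/2]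
    otherwise. Rounding the time stamps of a run of [A] gives a run of the
    discretization, with error below [1/2].

    Conversely, a path of the region automaton with prescribed integral weights
    is realised by a run of [A] in which every time stamp is an integer or has
    fractional part within [eps] of [1/2]: in terms of the present time and of
    the times of the last resets, a region only records the order of the
    fractional parts, so the fractional part of the next event may be chosen
    anywhere that is consistent with this order. A run of the discretization
    that takes an edge of weight [m^*] may drift away from the half-integers,
    but choosing the weight of the edge of [A] by rounding keeps the drift in
    [[-1/2, 1/2]]. The distance is thus at most [1/2 + eps]. *)

(** * Integral and fractional parts *)

Lemma Int_frac (x : R) :
  x = IZR (Int_part x) + frac_part x /\ 0 <= frac_part x < 1.
Proof.
  pose proof (base_fp x). split; [unfold frac_part; ring | lra].
Qed.

Lemma Int_frac_unique (x f : R) (z : Z) :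
  x = IZR z + f -> 0 <= f < 1 -> Int_part x = z /\ frac_part x = f.
Proof.
  intros E H.
  assert (I : Int_part x = z) by (symmetry; apply Int_part_spec; lra).
  split; [exact I | unfold frac_part; rewrite I; lra].
Qed.

Lemma frac_part_0 : frac_part 0 = 0.
Proof. apply (Int_frac_unique 0 0 0); lra. Qed.

Lemma Int_frac_minus_le (a b : R) :
  frac_part b <= frac_part a ->
  Int_part (a - b) = (Int_part a - Int_part b)%Z /\
  frac_part (a - b) = frac_part a - frac_part b.
Proof.
  intros H. destruct (Int_frac a), (Int_frac b).
  apply Int_frac_unique; [rewrite minus_IZR |]; lra.
Qed.

Lemma Int_frac_minus_lt (a b : R) :
  frac_part a < frac_part b ->
  Int_part (a - b) = (Int_part a - Int_part b - 1)%Z /\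
  frac_part (a - b) = frac_part a - frac_part b + 1.
Proof.
  intros H. destruct (Int_frac a), (Int_frac b).
  apply Int_frac_unique; [rewrite !minus_IZR |]; lra.
Qed.

Ltac frac_minus t x :=
  let X := fresh in
  destruct (Rle_lt_dec (frac_part x) (frac_part t)) as [X | X];
  [rewrite (proj2 (Int_frac_minus_le t x X)) | rewrite (proj2 (Int_frac_minus_lt t x X))].

(** The map [x -> t - x] reverses the circle of fractional parts and cuts it at [t]: points up to
    [t] come first, then those beyond, each group in reverse order. The right-hand side uses only
    comparisons that a region records. *)
Lemma frac_minus_le_minus (t x y : R) :
  frac_part (t - x) <= frac_part (t - y) <->
  (frac_part x <= frac_part t /\ ~ frac_part y <= frac_part t) \/
  ((frac_part x <= frac_part t <-> frac_part y <= frac_part t) /\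
   frac_part y <= frac_part x).
Proof.
  destruct (Int_frac x), (Int_frac y), (Int_frac t).
  frac_minus t x; frac_minus t y; split; intros; lra.
Qed.

Lemma frac_minus_le (t x : R) :
  frac_part (t - x) <= frac_part t <-> frac_part x <= frac_part t.
Proof.
  destruct (Int_frac x), (Int_frac t).
  frac_minus t x; split; intros; lra.
Qed.

Lemma frac_le_minus (t x : R) :
  frac_part t <= frac_part (t - x) <->
  frac_part x = 0 \/ ~ frac_part x <= frac_part t.
Proof.
  destruct (Int_frac x), (Int_frac t).
  frac_minus t x; split; intros; lra.
Qed.

Lemma frac_minus_eq0 (t x : R) :
  frac_part (t - x) = 0 <->
  frac_part x <= frac_part t /\ frac_part t <= frac_part x.
Proof.
  destruct (Int_frac x), (Int_frac t).
  frac_minus t x; split; intros; lra.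
Qed.

Lemma Int_part_mono (x y : R) : x <= y -> (Int_part x <= Int_part y)%Z.
Proof.
  intros H. destruct (Int_frac x), (Int_frac y).
  apply Z.lt_succ_r, lt_IZR. unfold Z.succ. rewrite plus_IZR. lra.
Qed.

(** * Regions *)

(** The part of [region_eq] free of integral parts, isolated because it can be carried through
    [reset_times]. *)
Definition frac_eq (s : nat) (w w' : extval) : Prop :=
  (forall i j, (i <= s)%nat -> (j <= s)%nat ->
     (frac_part (xval w i) <= frac_part (xval w j) <->
      frac_part (xval w' i) <= frac_part (xval w' j))) /\
  (forall i, (i <= s)%nat ->
     (frac_part (xval w i) = 0 <-> frac_part (xval w' i) = 0)).

(* Replaces every clock value by the time of its last reset; an involution. *)
Definition reset_times (w : extval) : extval :=
  (fst w, fun i => fst w - snd w i).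

(** Every comparison after the change of coordinates is a propositional combination of comparisons
    before it. As [reset_times] is an involution, this also serves for the way back. *)
Lemma frac_eq_reset_times (s : nat) (w w' : extval) :
  frac_eq s w w' -> frac_eq s (reset_times w) (reset_times w').
Proof.
  intros [Hle H0].
  assert (T0 := H0 0%nat (Nat.le_0_l _)).
  split.
  - intros [|i] [|j] Hi Hj; simpl in *.
    + lra.
    + rewrite !frac_le_minus.
      pose proof (Hle (S j) 0%nat Hj (Nat.le_0_l _)). pose proof (H0 _ Hj).
      simpl in *. tauto.
    + rewrite !frac_minus_le. exact (Hle (S i) 0%nat Hi (Nat.le_0_l _)).
    + rewrite !frac_minus_le_minus.
      pose proof (Hle (S j) 0%nat Hj (Nat.le_0_l _)).
      pose proof (Hle (S i) 0%nat Hi (Nat.le_0_l _)).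
      pose proof (Hle (S j) (S i) Hj Hi).
      simpl in *. tauto.
  - intros [|i] Hi; simpl in *; [exact T0 |].
    rewrite !frac_minus_eq0.
    pose proof (Hle (S i) 0%nat Hi (Nat.le_0_l _)).
    pose proof (Hle 0%nat (S i) (Nat.le_0_l _) Hi).
    simpl in *. tauto.
Qed.

Lemma frac_eq_ext (s : nat) (w1 w2 w1' w2' : extval) :
  (forall i, (i <= s)%nat -> xval w1 i = xval w1' i) ->
  (forall i, (i <= s)%nat -> xval w2 i = xval w2' i) ->
  frac_eq s w1 w2 -> frac_eq s w1' w2'.
Proof.
  intros E1 E2 [Hle H0]. split.
  - intros i j Hi Hj. rewrite <- !E1, <- !E2 by assumption. auto.
  - intros i Hi. rewrite <- E1, <- E2 by assumption. auto.
Qed.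

Lemma region_eq_refl (M s : nat) (w : extval) : region_eq M s w w.
Proof. repeat split; auto. Qed.

Lemma region_eq_ceil_frac (M s : nat) (w w' : extval) :
  region_eq M s w w' -> ceil_frac (fst w) = ceil_frac (fst w').
Proof.
  intros (_ & _ & H). specialize (H 0%nat (Nat.le_0_l _)). simpl in H.
  unfold ceil_frac.
  destruct (Req_EM_T (frac_part (fst w)) 0), (Req_EM_T (frac_part (fst w')) 0); tauto.
Qed.

(** Comparing [y] with an integer needs only the integral part of [y] and, in case of a tie, whether
    the fractional part vanishes. *)
Lemma cmp_INR_Int (y : R) (n : nat) :
  (Int_part y < Z.of_nat n)%Z /\ y < INR n \/
  Int_part y = Z.of_nat n /\ y = INR n + frac_part y \/
  (Z.of_nat n < Int_part y)%Z /\ INR n < y.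
Proof.
  destruct (Int_frac y) as [E F].
  rewrite INR_IZR_INZ.
  destruct (Z.lt_trichotomy (Int_part y) (Z.of_nat n)) as [H | [H | H]].
  - left. split; [exact H |].
    assert (IZR (Int_part y) + 1 <= IZR (Z.of_nat n))
      by (rewrite <- plus_IZR; apply IZR_le; lia). lra.
  - right; left. split; [exact H |]. rewrite <- H. exact E.
  - right; right. split; [exact H |]. apply IZR_lt in H. lra.
Qed.

(** A value above [M] stays above it. Otherwise the floors decide, except between [M] and [M + 1],
    where only the vanishing of the fractional part tells [Some M] from [None]. *)
Lemma capfloor_plus (M : nat) (x x0 d d0 : R) :
  0 <= d -> 0 <= d0 ->
  capfloor M x0 = capfloor M x ->
  (Int_part x0 = Int_part x -> Int_part (x0 + d0) = Int_part (x + d)) ->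
  (frac_part (x0 + d0) = 0 <-> frac_part (x + d) = 0) ->
  capfloor M (x0 + d0) = capfloor M (x + d).
Proof.
  intros Hd Hd0 Hc HI Hf. unfold capfloor in *.
  destruct (Rle_dec x0 (INR M)), (Rle_dec x (INR M)); try discriminate.
  - injection Hc as Hc. specialize (HI Hc).
    destruct (Int_frac (x + d)) as [_ F1], (Int_frac (x0 + d0)) as [_ F2].
    destruct (Rle_dec (x0 + d0) (INR M)), (Rle_dec (x + d) (INR M));
      try congruence;
      destruct (cmp_INR_Int (x + d) M) as [[]|[[]|[]]];
      destruct (cmp_INR_Int (x0 + d0) M) as [[]|[[]|[]]]; try lia; lra.
  - destruct (Rle_dec (x0 + d0) (INR M)), (Rle_dec (x + d) (INR M));
      try congruence; lra.
Qed.

Lemma sat_atom_region (M s : nat) (t t0 : R) (u u0 : nat -> R) (c : atom) (n : nat) :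
  region_eq M s (t0, u0) (t, u) -> (a_clk c < s)%nat ->
  a_const c = INR n -> a_const c <= INR M ->
  sat_atom u0 c -> sat_atom u c.
Proof.
  intros (Hcap & _ & H0) Hs Hn HM. specialize (Hcap _ Hs). specialize (H0 (S (a_clk c)) Hs).
  simpl in *. unfold sat_atom. rewrite Hn in *.
  unfold capfloor in Hcap.
  destruct (Int_frac (u (a_clk c))) as [_ F1], (Int_frac (u0 (a_clk c))) as [_ F2].
  destruct (Rle_dec (u0 (a_clk c)) (INR M)), (Rle_dec (u (a_clk c)) (INR M));
    try discriminate.
  - injection Hcap as Hcap.
    destruct (cmp_INR_Int (u (a_clk c)) n) as [[]|[[]|[]]];
      destruct (cmp_INR_Int (u0 (a_clk c)) n) as [[]|[[]|[]]]; try lia;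
      destruct (a_op c); lra.
  - destruct (a_op c); lra.
Qed.

(** Induction inserts the points one at a time, shrinking the gap from [(a, b)]. The origin of each
    endpoint is part of the induction hypothesis: it lets a new image be compared with the endpoint
    through [p]. *)
Lemma order_gap (n : nat) (p q : nat -> R) (e0 a b : R) :
  a < b ->
  (forall i j, (i < n)%nat -> (j < n)%nat -> (p i <= p j <-> q i <= q j)) ->
  (forall i, (i < n)%nat -> q i < b /\ (q i <= a -> p i < e0)) ->
  exists u w, a <= u /\ u < w /\ w <= b /\
    (u = a \/ exists i, (i < n)%nat /\ p i < e0 /\ u = q i) /\
    (w = b \/ exists i, (i < n)%nat /\ e0 < p i /\ w = q i) /\
    (forall i, (i < n)%nat -> (p i < e0 -> q i <= u) /\ (e0 < p i -> w <= q i)).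
Proof.
  intros Hab. induction n as [|n IH]; intros Hpq Hq.
  - exists a, b. repeat split; try lra; auto; lia.
  - destruct IH as (u & w & Hu & Huw & Hw & Cu & Cw & H);
      [intros; apply Hpq; lia | intros; apply Hq; lia |].
    destruct (Hq n (Nat.lt_succ_diag_r n)) as [Hb Ha].
    destruct (Rtotal_order (p n) e0) as [Hn | [Hn | Hn]].
    + exists (Rmax u (q n)), w.
      (* Either [w = b], or [w] is the image of a point above [e0], hence above [p n], and the order
         transfers. *)
      assert (q n < w).
      { destruct Cw as [-> | (j & Hj & Hpj & ->)]; [exact Hb |].
        destruct (Rle_lt_dec (q j) (q n)) as [C | C]; [| exact C].
        apply Hpq in C; [lra | lia | lia]. }
      pose proof (Rmax_l u (q n)). pose proof (Rmax_r u (q n)).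
      split; [lra |]. split; [apply Rmax_lub_lt; assumption |]. split; [assumption |].
      split; [| split].
      * unfold Rmax. destruct (Rle_dec u (q n)).
        -- right. exists n. repeat split; auto.
        -- destruct Cu as [| (i & Hi & Hpi & E)]; [left; assumption |].
           right. exists i. repeat split; auto.
      * destruct Cw as [| (i & Hi & Hpi & E)]; [left; assumption |].
        right. exists i. repeat split; auto.
      * intros i Hi. destruct (Nat.eq_dec i n) as [-> | Hne]; [lra |].
        destruct (H i ltac:(lia)). split; intros; [specialize (H3 H5) | auto]; lra.
    + exists u, w. split; [assumption |]. split; [assumption |]. split; [assumption |].
      split; [| split].
      * destruct Cu as [| (i & Hi & Hpi & E)]; [left; assumption |].
        right. exists i. repeat split; auto.
      * destruct Cw as [| (i & Hi & Hpi & E)]; [left; assumption |].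
        right. exists i. repeat split; auto.
      * intros i Hi. destruct (Nat.eq_dec i n) as [-> | Hne]; [lra |].
        apply H; lia.
    + exists u, (Rmin w (q n)).
      assert (u < q n).
      { destruct Cu as [-> | (j & Hj & Hpj & ->)].
        - destruct (Rle_lt_dec (q n) a) as [C | C]; [| exact C].
          apply Ha in C. lra.
        - destruct (Rle_lt_dec (q n) (q j)) as [C | C]; [| exact C].
          apply Hpq in C; [lra | lia | lia]. }
      pose proof (Rmin_l w (q n)). pose proof (Rmin_r w (q n)).
      split; [lra |]. split; [apply Rmin_glb_lt; assumption |]. split; [lra |].
      split; [| split].
      * destruct Cu as [| (i & Hi & Hpi & E)]; [left; assumption |].
        right. exists i. repeat split; auto.
      * unfold Rmin. destruct (Rle_dec w (q n)).
        -- destruct Cw as [| (i & Hi & Hpi & E)]; [left; assumption |].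
           right. exists i. repeat split; auto.
        -- right. exists n. repeat split; auto.
      * intros i Hi. destruct (Nat.eq_dec i n) as [-> | Hne]; [lra |].
        destruct (H i ltac:(lia)). split; intros; [auto | specialize (H4 H5)]; lra.
Qed.

Lemma order_extend (n : nat) (p q : nat -> R) (e0 a b : R) :
  a < b ->
  (forall i j, (i < n)%nat -> (j < n)%nat -> (p i <= p j <-> q i <= q j)) ->
  (forall i, (i < n)%nat -> q i < b /\ (q i <= a -> p i < e0)) ->
  exists e, a < e < b /\
    forall i, (i < n)%nat -> (p i <= e0 <-> q i <= e) /\ (e0 <= p i <-> e <= q i).
Proof.
  intros Hab Hpq Hq.
  (* A tie with an existing point forces [e] to be the image of that point; otherwise the midpoint
     of the gap works. *)
  destruct (classic (exists i, (i < n)%nat /\ p i = e0)) as [(k & Hk & <-) | Hne].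
  - exists (q k). split.
    + destruct (Hq k Hk). split; [| assumption].
      destruct (Rle_lt_dec (q k) a) as [C | C]; [| exact C].
      specialize (H0 C). lra.
    + intros i Hi. split; apply Hpq; assumption.
  - destruct (order_gap n p q e0 a b Hab Hpq Hq) as (u & w & Hu & Huw & Hw & _ & _ & H).
    exists ((u + w) / 2). split; [lra |].
    intros i Hi. specialize (H i Hi).
    assert (p i <> e0) by (intros E; apply Hne; exists i; auto).
    destruct (Rtotal_order (p i) e0) as [Hn | [Hn | Hn]]; [| lra |];
      destruct H as [H1 H2]; [specialize (H1 Hn) | specialize (H2 Hn)]; split; lra.
Qed.

(** * Matching a step from an equivalent valuation *)

Definition near_half (eps : R) (y : R) : Prop :=
  frac_part y = 0 \/ 1/2 - eps < frac_part y < 1/2 + eps.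

(** Imposed on reset times rather than on clock values, because a delay leaves the reset times
    fixed. *)
Definition half_aligned (eps : R) (s : nat) (w : extval) : Prop :=
  forall i, (i <= s)%nat -> near_half eps (xval (reset_times w) i).

Lemma reset_times_step (C : list nat) (t d : R) (v : nat -> R) (i : nat) :
  xval (reset_times (t + d, reset C (shift v d))) i =
  match i with
  | O => t + d
  | S j => if in_dec Nat.eq_dec j C then t + d else xval (reset_times (t, v)) i
  end.
Proof.
  destruct i as [|j]; simpl; [reflexivity |].
  unfold reset, shift. destruct (in_dec Nat.eq_dec j C); ring.
Qed.

(* The next event time of the second run is placed among the fractional parts
   of its reset times as the event [t0 + d0] is placed among those of the first
   run, and near [1/2] unless it has to be an integer. *)
Lemma region_step (M s : nat) (eps t0 d0 t : R) (v0 v : nat -> R) :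
  0 < eps < 1/2 ->
  region_eq M s (t0, v0) (t, v) -> 0 <= d0 -> half_aligned eps s (t, v) ->
  exists d, 0 <= d /\
    (Int_part (t + d) - Int_part t = Int_part (t0 + d0) - Int_part t0)%Z /\
    forall C,
      region_eq M s (t0 + d0, reset C (shift v0 d0)) (t + d, reset C (shift v d)) /\
      half_aligned eps s (t + d, reset C (shift v d)).
Proof.
  intros Heps (Hcap & Hfr) Hd0 Hal.
  pose proof (frac_eq_reset_times _ _ _ Hfr) as [Hle H0].
  set (p := fun i => frac_part (xval (reset_times (t0, v0)) i)).
  set (q := fun i => frac_part (xval (reset_times (t, v)) i)).
  set (e0 := frac_part (t0 + d0)).
  assert (Fe0 : 0 <= e0 < 1) by apply (Int_frac (t0 + d0)).
  assert (Hp : forall i, 0 <= p i < 1) by (intros i; apply Int_frac).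
  assert (Hq : forall i, 0 <= q i < 1) by (intros i; apply Int_frac).
  assert (Hpq : forall i j, (i < S s)%nat -> (j < S s)%nat -> (p i <= p j <-> q i <= q j))
    by (intros; apply Hle; lia).
  assert (He : exists e, 0 <= e < 1 /\ (e = 0 \/ 1/2 - eps < e < 1/2 + eps) /\
    (e0 = 0 <-> e = 0) /\
    forall i, (i < S s)%nat -> (p i <= e0 <-> q i <= e) /\ (e0 <= p i <-> e <= q i)).
  { destruct (Req_EM_T e0 0) as [E | E].
    - exists 0. split; [lra |]. split; [lra |]. split; [lra |].
      intros i Hi. specialize (Hp i). specialize (Hq i).
      assert (p i = 0 <-> q i = 0) by (apply H0; lia). lra.
    - destruct (order_extend (S s) p q e0 (1/2 - eps) (1/2 + eps)) as (e & Hab & H);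
        [lra | exact Hpq | | exists e; repeat split; try lra; apply H; assumption].
      (* By alignment, [q i <= 1/2 - eps] is possible only for [q i = 0]; then [p i = 0 < e0]. *)
      intros i Hi. assert (Z : p i = 0 <-> q i = 0) by (apply H0; lia).
      destruct (Hal i ltac:(lia)) as [N | N]; fold (q i) in N; lra. }
  destruct He as (e & Fe & Ne & Ze & He).
  set (m := (Int_part (t0 + d0) - Int_part t0)%Z).
  set (t' := IZR (Int_part t + m) + e).
  destruct (Int_frac_unique t' e (Int_part t + m) eq_refl Fe) as [It' Ft'].
  destruct (Int_frac t) as [Et Ft], (Int_frac t0) as [Et0 Ft0],
    (Int_frac (t0 + d0)) as [Et0' _].
  (* If [m = 0], the fractional part of [t0] is at most [e0], so that of [t] is at most [e]. If
     [m >= 1], [t'] lies beyond the next integer after [t]. *)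
  assert (Hd : t <= t').
  { unfold t'. rewrite plus_IZR.
    assert (Hm : (0 <= m)%Z)
      by (assert (Int_part t0 <= Int_part (t0 + d0))%Z by (apply Int_part_mono; lra);
          unfold m; lia).
    destruct (Z.eq_dec m 0) as [Em | Em].
    - assert (IZR (Int_part (t0 + d0)) = IZR (Int_part t0)) by (f_equal; unfold m in Em; lia).
      assert (q 0%nat <= e) by (apply He; [lia |]; unfold p, e0; simpl; lra).
      change (q 0%nat) with (frac_part t) in *. rewrite Em. lra.
    - assert (1 <= IZR m) by (apply (IZR_le 1); lia). lra. }
  exists (t' - t). replace (t + (t' - t)) with t' by ring.
  split; [lra |]. split; [rewrite It'; unfold m; lia |].
  intros C.
  assert (X0 := reset_times_step C t0 d0 v0).
  assert (X := reset_times_step C t (t' - t) v).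
  replace (t + (t' - t)) with t' in X by ring.
  assert (FR : frac_eq s (reset_times (t0 + d0, reset C (shift v0 d0)))
                         (reset_times (t', reset C (shift v (t' - t))))).
  { split.
    - intros i j Hi Hj. rewrite !X0, !X.
      destruct i as [|i]; [| destruct (in_dec Nat.eq_dec i C)];
      (destruct j as [|j]; [| destruct (in_dec Nat.eq_dec j C)]);
      try rewrite Ft'; fold e0;
      try (split; intros; lra);
      try (apply (He (S i)); lia); try (apply (He (S j)); lia); apply Hle; assumption.
    - intros i Hi. rewrite X0, X.
      destruct i as [|i]; [| destruct (in_dec Nat.eq_dec i C)];
      try rewrite Ft'; fold e0; try exact Ze. apply H0; assumption. }
  assert (FR' : frac_eq s (t0 + d0, reset C (shift v0 d0)) (t', reset C (shift v (t' - t)))).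
  { apply frac_eq_reset_times in FR. revert FR. apply frac_eq_ext.
    - intros [|i] _; simpl; ring.
    - intros [|i] _; simpl; ring. }
  split; [split; [| exact FR'] |].
  - intros i Hi. pose proof (proj2 FR' (S i) Hi) as Z. simpl in Z |- *.
    unfold reset, shift in *. destruct (in_dec Nat.eq_dec i C); [reflexivity |].
    apply capfloor_plus; [lra | lra | exact (Hcap i Hi) | | exact Z].
    (* A clock is the present time minus its reset time, so its floor is the difference of their
       floors, less 1 if the reset time has the larger fractional part. This correction agrees in
       both runs, before and after the delay. *)
    assert (Ho := He (S i) ltac:(lia)). assert (Ho' := Hpq (S i) 0%nat ltac:(lia) ltac:(lia)).
    unfold p, q in Ho, Ho'. simpl in Ho, Ho'.
    replace (v0 i + d0) with (t0 + d0 - (t0 - v0 i)) by ring.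
    replace (v i + (t' - t)) with (t' - (t - v i)) by ring.
    replace (v0 i) with (t0 - (t0 - v0 i)) at 1 by ring.
    replace (v i) with (t - (t - v i)) at 1 by ring.
    set (a0 := t0 - v0 i) in *. set (a := t - v i) in *.
    intros EI.
    assert (EI' : (Int_part t0 - Int_part a0 = Int_part t - Int_part a)%Z).
    { destruct (Rle_lt_dec (frac_part a0) (frac_part t0)) as [G | G].
      - rewrite (proj1 (Int_frac_minus_le _ _ G)) in EI. apply Ho' in G.
        rewrite (proj1 (Int_frac_minus_le _ _ G)) in EI. exact EI.
      - assert (G' : frac_part t < frac_part a) by lra.
        rewrite (proj1 (Int_frac_minus_lt _ _ G)), (proj1 (Int_frac_minus_lt _ _ G')) in EI.
        lia. }
    destruct (Rle_lt_dec (frac_part a0) e0) as [G | G].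
    + assert (G' : frac_part a <= frac_part t') by (rewrite Ft'; apply Ho, G).
      rewrite (proj1 (Int_frac_minus_le _ _ G)), (proj1 (Int_frac_minus_le _ _ G')).
      unfold m in It'. lia.
    + assert (G' : frac_part t' < frac_part a) by (rewrite Ft'; lra).
      rewrite (proj1 (Int_frac_minus_lt _ _ G)), (proj1 (Int_frac_minus_lt _ _ G')).
      unfold m in It'. lia.
  - intros i Hi. rewrite X.
    assert (near_half eps t') by (unfold near_half; rewrite Ft'; exact Ne).
    destruct i as [|i]; [assumption |].
    destruct (in_dec Nat.eq_dec i C); [assumption | apply Hal; assumption].
Qed.

(** The edge is witnessed by a step from some valuation in [r]; [region_step] replays its transition
    from [(t, v)] with the same weight. *)
Lemma weighted_edge_step {L Sigma} (A : TA L Sigma) (M : nat) (eps : R)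
    (q : L) (r : region) (a : Sigma) (q' : L) (r' : region) (m : nat)
    (t : R) (v : nat -> R) :
  finite_TA A -> nat_constants A -> is_max_const A M -> 0 < eps < 1/2 ->
  weighted_edge A M q r a q' r' m ->
  r (t, v) -> half_aligned eps (ta_nclocks A) (t, v) ->
  exists d tr, 0 <= d /\ ta_trans A tr /\ t_src tr = q /\ t_act tr = a /\ t_dst tr = q' /\
    sat_guard (t_guard tr) (shift v d) /\
    IZR (Int_part (t + d)) = IZR (Int_part t) + INR m /\
    r' (t + d, reset (t_reset tr) (shift v d)) /\
    half_aligned eps (ta_nclocks A) (t + d, reset (t_reset tr) (shift v d)).
Proof.
  intros (_ & _ & _ & Hclk) HN [HM _] Heps
    (v0 & t0 & d0 & tr & _ & Hd0 & Htr & Hsrc & Hact & Hdst & Hg & -> & -> & Hm) Hr Hal.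
  destruct (region_step M _ eps t0 d0 t v0 v Heps Hr Hd0 Hal) as (d & Hd & HI & HC).
  exists d, tr. destruct (HC (t_reset tr)) as [Hr' Hal'].
  repeat (split; [assumption |]).
  split; [| split; [| split; assumption]].
  (* The empty reset set gives the regions just before the jump, where the guard is evaluated. *)
  - destruct (HC []) as [Hr0 _].
    apply Forall_forall. intros c Hc.
    destruct (HN tr c Htr Hc) as [n Hn].
    apply (sat_atom_region M (ta_nclocks A) (t + d) (t0 + d0)
             (reset [] (shift v d)) (reset [] (shift v0 d0)) c n Hr0).
    + destruct (Hclk tr Htr) as [G _]. rewrite Forall_forall in G. apply G, Hc.
    + exact Hn.
    + exact (HM tr c Htr Hc).
    + unfold sat_guard in Hg. rewrite Forall_forall in Hg. exact (Hg c Hc).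
  - rewrite Hm, <- minus_IZR, <- HI, minus_IZR. ring.
Qed.

(** * Distances between languages *)

Definition close {Sigma} (c : R) (t1 t2 : timed_trace Sigma) : Prop :=
  Forall2 (fun x y => snd x = snd y /\ Rabs (fst x - fst y) <= c) t1 t2.

Lemma tdist_close {Sigma} (c : R) (t1 t2 : timed_trace Sigma) :
  0 <= c -> close c t1 t2 -> Rbar_le (tdist t1 t2) (Finite c).
Proof.
  intros Hc. induction 1 as [| [x1 a1] [x2 a2] r1 r2 [E D] _ IH]; simpl in *; [exact Hc |].
  destruct (excluded_middle_informative (a1 = a2)) as [_ | N]; [| contradiction].
  destruct (tdist r1 r2); simpl in *; [| contradiction | assumption].
  apply Rmax_lub; assumption.
Qed.

(** The infimum inside [conf] absorbs the slack [eps]. *)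
Lemma conf_le {Sigma} (L1 L2 : timed_trace Sigma -> Prop) (c : R) :
  0 <= c ->
  (forall eps, 0 < eps < 1/2 -> forall t1, L1 t1 -> exists t2, L2 t2 /\ close (c + eps) t1 t2) ->
  Rbar_le (conf L1 L2) (Finite c).
Proof.
  intros Hc H. unfold conf.
  apply (proj2_sig (Rbar_ex_lub _)). intros x (t1 & Ht1 & ->).
  pose proof (proj1 (proj2_sig (Rbar_ex_glb (fun y => exists t2, L2 t2 /\ y = tdist t1 t2))))
    as Hlb.
  unfold Rbar_glb. set (g := proj1_sig _) in *.
  assert (Hg : forall eps, 0 < eps < 1/2 -> Rbar_le g (Finite (c + eps))).
  { intros eps Heps. destruct (H eps Heps t1 Ht1) as (t2 & Ht2 & Hcl).
    apply Rbar_le_trans with (tdist t1 t2).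
    - apply Hlb. exists t2. auto.
    - apply tdist_close; [lra | exact Hcl]. }
  destruct g as [x | |]; simpl in *; [| exact (Hg (1/4) ltac:(lra)) | exact I].
  destruct (Rle_lt_dec x c) as [| C]; [assumption |].
  (* Half the excess over [c] contradicts the bound; [1/4] keeps [eps] in its range. *)
  pose proof (Rmin_l ((x - c) / 2) (1/4)). pose proof (Rmin_r ((x - c) / 2) (1/4)).
  assert (0 < Rmin ((x - c) / 2) (1/4)) by (apply Rmin_glb_lt; lra).
  specialize (Hg (Rmin ((x - c) / 2) (1/4)) ltac:(lra)). lra.
Qed.

Lemma Rbar_maxb_lub (x y z : Rbar) :
  Rbar_le x z -> Rbar_le y z -> Rbar_le (Rbar_maxb x y) z.
Proof.
  destruct x, y, z; simpl; auto. apply Rmax_lub.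
Qed.

(** * From the automaton to its discretization *)

(** This rounding fits the guards: between two events the rounded times differ by the weight plus
    [delta]. *)
Definition half_round (t : R) : R := IZR (Int_part t) + ceil_frac t / 2.

Lemma half_round_dist (t : R) : Rabs (t - half_round t) <= 1/2.
Proof.
  destruct (Int_frac t). unfold half_round, ceil_frac.
  destruct (Req_EM_T (frac_part t) 0); apply Rabs_le; lra.
Qed.

(** Ensures that the delays of the rounded run are nonnegative. *)
Lemma half_round_mono (x y : R) : x <= y -> half_round x <= half_round y.
Proof.
  intros H. pose proof (Int_part_mono x y H) as HI.
  destruct (Int_frac x), (Int_frac y).
  assert (0 <= ceil_frac x <= 1 /\ 0 <= ceil_frac y <= 1)
    by (unfold ceil_frac; destruct (Req_EM_T (frac_part x) 0), (Req_EM_T (frac_part y) 0); lra).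
  unfold half_round. destruct (Z.eq_dec (Int_part x) (Int_part y)) as [E | E].
  - rewrite E in *. unfold ceil_frac.
    destruct (Req_EM_T (frac_part x) 0), (Req_EM_T (frac_part y) 0); lra.
  - assert (IZR (Int_part x) + 1 <= IZR (Int_part y))
      by (rewrite <- plus_IZR; apply IZR_le; lia). lra.
Qed.

(** Supplies the base weight of the [m^*] edge, which [disc_trans] requires to be least. *)
Lemma least_tail (W : nat -> Prop) (m : nat) :
  (forall j, (m <= j)%nat -> W j) ->
  exists m0, (m0 <= m)%nat /\ (forall j, (m0 <= j)%nat -> W j) /\
    (m0 = 0%nat \/ ~ W (m0 - 1)%nat).
Proof.
  induction m as [|m IH]; intros H.
  - exists 0%nat. auto.
  - destruct (classic (W m)) as [Hm | Hm].
    + destruct IH as (m0 & Hle & H').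
      * intros j Hj. destruct (Nat.eq_dec m j) as [<- |]; [exact Hm | apply H; lia].
      * exists m0. split; [lia | exact H'].
    + exists (S m). split; [lia |]. split; [exact H |]. right.
      simpl. rewrite Nat.sub_0_r. exact Hm.
Qed.

(** The discrete run passes through the regions of the given run at the rounded times. Reachability
    is carried along because [weighted_edge] asks for it. *)
Lemma acc_run_discretize {L Sigma} (A : TA L Sigma) (M : nat)
    (q : L) (v : nat -> R) (t : R) (tau : timed_trace Sigma) :
  acc_run A q v t tau -> reach A q v t ->
  forall u, u 0%nat = 0 ->
  exists tau', acc_run (discretize A M) (q, region_of M (ta_nclocks A) (t, v)) u
                 (half_round t) tau' /\
    close (1/2) tau tau'.
Proof.
  induction 1 as [q v t Hacc | q v t d tr rest Hd Htr Hsrc Hg Hrun IH]; intros Hreach u Hu.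
  - exists []. split; [constructor; exact Hacc | constructor].
  - pose proof (reach_step A q v t d tr Hreach Hd Htr Hsrc Hg) as Hreach'.
    set (v' := reset (t_reset tr) (shift v d)) in *.
    set (r := region_of M (ta_nclocks A) (t, v)).
    set (r' := region_of M (ta_nclocks A) (t + d, v')).
    assert (HI : (Int_part t <= Int_part (t + d))%Z) by (apply Int_part_mono; lra).
    set (m := Z.to_nat (Int_part (t + d) - Int_part t)).
    assert (Hm : INR m = IZR (Int_part (t + d)) - IZR (Int_part t))
      by (unfold m; rewrite INR_IZR_INZ, Z2Nat.id, minus_IZR by lia; reflexivity).
    set (W := weighted_edge A M q r (t_act tr) (t_dst tr) r').
    assert (HW : W m).
    { exists v, t, d, tr. repeat split; assumption. }
    set (delta := (ceil_frac (t + d) - ceil_frac t) / 2).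
    set (D := half_round (t + d) - half_round t).
    assert (HD : D = INR m + delta) by (unfold D, half_round, delta; rewrite Hm; field).
    assert (D0 : 0 <= D) by (assert (half_round t <= half_round (t + d))
                               by (apply half_round_mono; lra); unfold D; lra).
    assert (Hg' : exists g, disc_trans A M (mkTrans (q, r) (t_act tr) g [0%nat] (t_dst tr, r')) /\
                       sat_guard g (shift u D)).
    (* If all weights from [m] on occur, [m] is absorbed by the edge of weight [m0^*] with
       [m0 <= m]; otherwise it has an equality edge of its own. *)
    { destruct (classic (forall j, (m <= j)%nat -> W j)) as [Htail | Htail].
      - destruct (least_tail W m Htail) as (m0 & Hm0 & Ht0 & Hmin).
        exists [mkAtom 0 CGe (INR m0 + delta)]. split.
        + exists q, (t, v), (t_act tr), (t_dst tr), (t + d, v').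
          simpl. repeat (split; [reflexivity |]). right. exists m0. auto.
        + constructor; [| constructor]. unfold sat_atom, shift. simpl.
          rewrite Hu, HD. apply le_INR in Hm0. lra.
      - exists [mkAtom 0 CEq (INR m + delta)]. split.
        + exists q, (t, v), (t_act tr), (t_dst tr), (t + d, v').
          simpl. repeat (split; [reflexivity |]). left. exists m. auto.
        + constructor; [| constructor]. unfold sat_atom, shift. simpl. lra. }
    destruct Hg' as (g & Hdt & Hsat).
    destruct (IH Hreach' (reset [0%nat] (shift u D)) eq_refl) as (tau' & Hrun' & Hcl).
    replace (half_round (t + d)) with (half_round t + D) in Hrun' by (unfold D; ring).
    exists ((half_round t + D, t_act tr) :: tau'). split.
    + apply (acc_cons (discretize A M) (q, r) u (half_round t) D
               (mkTrans (q, r) (t_act tr) g [0%nat] (t_dst tr, r')) tau');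
        [exact D0 | exact Hdt | reflexivity | exact Hsat | exact Hrun'].
    + constructor; [| exact Hcl]. simpl. split; [reflexivity |].
      replace (half_round t + D) with (half_round (t + d)) by (unfold D; ring).
      apply half_round_dist.
Qed.

(** * From the discretization to the automaton *)

(** An aligned time is within [eps] of its rounding, and the drift adds at most [1/2]. *)
Lemma half_round_near (eps t theta : R) :
  near_half eps t -> 0 < eps -> -1/2 <= theta <= 1/2 ->
  Rabs (half_round t + theta - t) <= 1/2 + eps.
Proof.
  intros N He Ht. destruct (Int_frac t). unfold half_round, ceil_frac, near_half in *.
  destruct (Req_EM_T (frac_part t) 0); apply Rabs_le; lra.
Qed.

(* [theta] is the drift of the discrete run from the half-integral grid. *)
Lemma acc_run_undiscretize {L Sigma} (A : TA L Sigma) (M : nat) (eps : R)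
    (p : vertex L) (u : nat -> R) (now : R) (tau : timed_trace Sigma) :
  finite_TA A -> nat_constants A -> is_max_const A M -> 0 < eps < 1/2 ->
  acc_run (discretize A M) p u now tau -> u 0%nat = 0 ->
  forall t v theta, snd p (t, v) -> half_aligned eps (ta_nclocks A) (t, v) ->
  -1/2 <= theta <= 1/2 -> now = half_round t + theta ->
  exists tau', acc_run A (fst p) v t tau' /\ close (1/2 + eps) tau tau'.
Proof.
  intros HF HN HM Heps.
  induction 1 as [p u now Hacc | p u now D tr rest HD Htr Hsrc Hg Hrun IH];
    intros Hu t v theta Hr Hal Hth Hnow.
  - exists []. split; [constructor; exact Hacc | constructor].
  - destruct Htr as (q & w & a & q' & w' & Htr). simpl in Htr.
    destruct Htr as (Hs & Ha & Hdst & Hres & Hguard).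
    rewrite Hs in Hsrc. subst p. simpl in Hr |- *.
    rewrite Hdst, Hres in *.
    set (r := region_of M (ta_nclocks A) w) in *.
    set (r' := region_of M (ta_nclocks A) w') in *.
    set (delta := (ceil_frac (fst w') - ceil_frac (fst w)) / 2) in *.
    assert (Hj : exists j theta', weighted_edge A M q r a q' r' j /\ -1/2 <= theta' <= 1/2 /\
                   D + theta = INR j + delta + theta').
    { destruct Hguard as [(m & HW & _ & E) | (m & HW & _ & E)];
        rewrite E in Hg; inversion_clear Hg as [| ? ? Hat _];
        unfold sat_atom, shift in Hat; simpl in Hat; rewrite Hu in Hat.
      (* An equality guard leaves the drift unchanged. *)
      - exists m, theta. split; [exact HW |]. split; lra.
      (* Adding [1/2] makes the floor round to the nearest integer, and the new drift is the
         remainder. The guard and [theta >= -1/2] give [y >= 0], so the chosen weight is at least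
         [m]. *)
      - set (y := D + theta - INR m - delta + 1/2).
        destruct (Int_frac y) as [Ey Fy].
        assert (Hk : (0 <= Int_part y)%Z).
        { apply Z.lt_succ_r, lt_IZR. unfold Z.succ. rewrite plus_IZR.
          unfold y in *. lra. }
        exists (m + Z.to_nat (Int_part y))%nat, (frac_part y - 1/2).
        split; [apply HW; lia |]. split; [lra |].
        rewrite plus_INR, (INR_IZR_INZ (Z.to_nat _)), Z2Nat.id by exact Hk.
        unfold y in *. lra. }
    destruct Hj as (j & theta' & HW & Hth' & Hdist).
    destruct (weighted_edge_step A M eps q r a q' r' j t v HF HN HM Heps HW Hr Hal)
      as (d & tr' & Hd & Htr' & Hsrc' & Hact' & Hdst' & Hg' & HI & Hr' & Hal').
    set (v' := reset (t_reset tr') (shift v d)) in *.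
    (* [ceil_frac] is constant on regions, so [delta], defined from the representatives [w] and
       [w'], is also the one for [t] and [t + d]. *)
    assert (Hnow' : now + D = half_round (t + d) + theta').
    { apply region_eq_ceil_frac in Hr. apply region_eq_ceil_frac in Hr'. simpl in Hr, Hr'.
      rewrite Hnow. unfold half_round. rewrite HI, <- Hr', <- Hr.
      unfold delta in Hdist. lra. }
    destruct (IH eq_refl (t + d) v' theta' Hr' Hal' Hth' Hnow') as (tau' & Hrun' & Hcl).
    exists ((t + d, t_act tr') :: tau'). split.
    + apply acc_cons; try assumption. rewrite Hdst'. exact Hrun'.
    + constructor; [| exact Hcl]. simpl. split; [congruence |].
      rewrite Hnow'. apply half_round_near; [| lra | exact Hth'].
      exact (Hal' 0%nat (Nat.le_0_l _)).
Qed.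

Lemma half_round_0 : half_round 0 = 0.
Proof.
  unfold half_round, ceil_frac. rewrite frac_part_0.
  destruct (Req_EM_T 0 0) as [_ | N]; [| contradiction].
  rewrite (proj1 (Int_frac_unique 0 0 0 ltac:(lra) ltac:(lra))). field.
Qed.

Theorem theorem2 (L Sigma : Type) (A : TA L Sigma) (M : nat) :
  finite_TA A -> nat_constants A -> is_max_const A M ->
  Rbar_le (lang_dist (lang A) (lang (discretize A M))) (Finite (1/2)).
Proof.
  intros HF HN HM. apply Rbar_maxb_lub; apply conf_le; try lra; intros eps Heps tau Htau.
  - destruct (acc_run_discretize A M _ _ _ tau Htau (reach_init A) zero_val eq_refl)
      as (tau' & Hrun & Hcl).
    exists tau'. split.
    + unfold lang. rewrite <- half_round_0. exact Hrun.
    + revert Hcl. apply Forall2_impl. intros x y [E D]. split; [exact E | lra].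
  (* Both runs start at time 0, so the initial drift is 0. *)
  - destruct (acc_run_undiscretize A M eps _ _ _ tau HF HN HM Heps Htau eq_refl 0 zero_val 0)
      as (tau' & Hrun & Hcl).
    + apply region_eq_refl.
    + intros i _. left. destruct i; simpl; unfold zero_val; rewrite ?Rminus_0_r; apply frac_part_0.
    + lra.
    + rewrite half_round_0. ring.
    + exists tau'. split; [exact Hrun | exact Hcl].
Qed.
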